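(* Let $\mathbb{F}$ be a field and $\Xi\subset\mathbb{F}^2$ a finite nonempty set. If $\Xi$ is $x$-tower, then the Gröbner éscalier of the vanishing ideal $\mathcal{I}(\Xi)$ w.r.t. $\prec_{\mathrm{grlex}}$ is $\mathfrak{M}_{S_x(\Xi)}=\{x^iy^j:(i,j)\in S_x(\Xi)\}$. If $\Xi$ is $y$-tower, then the Gröbner éscalier of $\mathcal{I}(\Xi)$ w.r.t. $\prec_{\mathrm{grevlex}}$ is $\mathfrak{M}_{S_y(\Xi)}=\{x^iy^j:(i,j)\in S_y(\Xi)\}$.
   Context: $\mathbb{N}_0$ is the set of nonnegative integers. For a finite nonempty $\Xi\subset\mathbb{F}^2$, $\mathcal{I}(\Xi)\subset\mathbb{F}[x,y]$ is the ideal of polynomials vanishing on $\Xi$. For a monomial order $\prec$, the Gröbner éscalier of $\mathcal{I}(\Xi)$ w.r.t. $\prec$ is the set of monomials not divisible by the leading monomial of any element of the reduced Gröbner basis of $\mathcal{I}(\Xi)$ w.r.t. $\prec$. The orders: $x^iy^j\prec_{\mathrm{grlex}}x^my^n$ iff $i+j<m+n$, or $i+j=m+n$ and $i<m$; $x^iy^j\prec_{\mathrm{grevlex}}x^my^n$ iff $i+j<m+n$, or $i+j=m+n$ and $j>n$. A finite nonempty $\mathcal{A}\subset\mathbb{N}_0^2$ is lower if $(i,j)\in\mathcal{A}$, $0\le i'\le i$, $0\le j'\le j$ imply $(i',j')\in\mathcal{A}$; $\mathrm{b}_x(\mathcal{A})=\max\{i:(i,0)\in\mathcal{A}\}$, $\mathrm{b}_y(\mathcal{A})=\max\{j:(0,j)\in\mathcal{A}\}$.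 For nonincreasing sequences of nonnegative integers, $\mathrm{L}_x(m_0,\ldots,m_b)=\{(i,j):0\le j\le b,\ 0\le i\le m_j\}$ and $\mathrm{L}_y(n_0,\ldots,n_b)=\{(i,j):0\le i\le b,\ 0\le j\le n_i\}$. Every lower set can be written uniquely in each form; it is $x$-strict if the sequence $m_0,m_1,\ldots$ is strictly decreasing, and $y$-strict if $n_0,n_1,\ldots$ is strictly decreasing. $\pi_x,\pi_y$ are the coordinate projections. Let $\Xi_0^x,\ldots,\Xi_{\#\pi_y(\Xi)-1}^x$ be the sets $\Xi\cap\{y=\bar y\}$, $\bar y\in\pi_y(\Xi)$, enumerated with nonincreasing cardinalities, and $\Xi_0^y,\ldots,\Xi_{\#\pi_x(\Xi)-1}^y$ the sets $\Xi\cap\{x=\bar x\}$, $\bar x\in\pi_x(\Xi)$, enumerated with nonincreasing cardinalities. Put $S_x(\Xi)=\mathrm{L}_x(\#\Xi_0^x-1,\ldots,\#\Xi_{\#\pi_y(\Xi)-1}^x-1)$ and $S_y(\Xi)=\mathrm{L}_y(\#\Xi_0^y-1,\ldots,\#\Xi_{\#\pi_x(\Xi)-1}^y-1)$. $\Xi$ is $x$-tower if $S_x(\Xi)$ is $x$-strict and there are injective functions $\mathrm{x}:\{0,\ldots,\mathrm{b}_x(S_x(\Xi))\}\to\mathbb{F}$, $\mathrm{y}:\{0,\ldots,\mathrm{b}_y(S_x(\Xi))\}\to\mathbb{F}$ and permutations $\sigma_0^x,\ldots,\sigma_{\mathrm{b}_y(S_x(\Xi))}^x$ of $\{0,\ldots,\mathrm{b}_x(S_x(\Xi))\}$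 with $\Xi=\{(\mathrm{x}(\sigma_j^x(i)),\mathrm{y}(j)):(i,j)\in S_x(\Xi)\}$. $\Xi$ is $y$-tower if $S_y(\Xi)$ is $y$-strict and there are injective functions $\mathrm{x}:\{0,\ldots,\mathrm{b}_x(S_y(\Xi))\}\to\mathbb{F}$, $\mathrm{y}:\{0,\ldots,\mathrm{b}_y(S_y(\Xi))\}\to\mathbb{F}$ and permutations $\sigma_0^y,\ldots,\sigma_{\mathrm{b}_x(S_y(\Xi))}^y$ of $\{0,\ldots,\mathrm{b}_y(S_y(\Xi))\}$ with $\Xi=\{(\mathrm{x}(i),\mathrm{y}(\sigma_i^y(j))):(i,j)\in S_y(\Xi)\}$. *)

(* Defs.v *)
From HB Require Import structures.
From mathcomp Require Import all_boot all_algebra all_fingroup.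
From mathcomp Require Import finmap.
From mathcomp.multinomials Require Import mpoly.

Set Implicit Arguments.
Unset Strict Implicit.
Unset Printing Implicit Defensive.

Import GRing.Theory.

Local Open Scope ring_scope.
Local Open Scope fset_scope.

(* Monomials and leading monomials with respect to an arbitrary strict order  *)
(* on monomials: [ord m1 m2] means that m1 strictly precedes m2.  The [mlead] *)
(* of the library cannot be used since it is tied to one fixed order.         *)

Definition larger_mon (n : nat) (ord : rel 'X_{1..n}) (m1 m2 : 'X_{1..n}) :=
  if ord m1 m2 then m2 else m1.

(* As for [mlead], the value at p = 0 is the default 0%MM.                    *)
Definition lead_mon (F : fieldType) (n : nat) (ord : rel 'X_{1..n})
    (p : {mpoly F[n]}) : 'X_{1..n} :=
  \big[larger_mon ord / 0%MM]_(m <- msupp p) m.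

(* On monomials, (m1 <= m2)%MM is divisibility.                               *)
Definition groebner_basis (F : fieldType) (n : nat) (ord : rel 'X_{1..n})
    (I : {pred {mpoly F[n]}}) (G : {fset {mpoly F[n]}}) : Prop :=
  [/\ {subset G <= I},
      0 \notin G
    & forall f, f \in I -> f != 0 ->
        exists2 g, g \in G & (lead_mon ord g <= lead_mon ord f)%MM].

Definition reduced_groebner_basis (F : fieldType) (n : nat)
    (ord : rel 'X_{1..n}) (I : {pred {mpoly F[n]}})
    (G : {fset {mpoly F[n]}}) : Prop :=
  [/\ groebner_basis ord I G,
      forall g, g \in G -> g@_(lead_mon ord g) = 1
    & forall g h m, g \in G -> h \in G -> h != g -> m \in msupp g ->
        ~~ (lead_mon ord h <= m)%MM].

(* For a monomial order the reduced Groebner basis of an ideal is unique, so  *)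
(* the existential quantifier speaks about the reduced Groebner basis.        *)
Definition groebner_escalier (F : fieldType) (n : nat) (ord : rel 'X_{1..n})
    (I : {pred {mpoly F[n]}}) (m : 'X_{1..n}) : Prop :=
  exists2 G : {fset {mpoly F[n]}}, reduced_groebner_basis ord I G
    & forall g, g \in G -> ~~ (lead_mon ord g <= m)%MM.

(* The bivariate case: x is the variable of index 0 and y that of index 1.    *)

Definition xexp (m : 'X_{1..2}) : nat := m ord0.
Definition yexp (m : 'X_{1..2}) : nat := m ord_max.

Definition grlex : rel 'X_{1..2} := fun m1 m2 =>
  (xexp m1 + yexp m1 < xexp m2 + yexp m2)%N
  || (xexp m1 + yexp m1 == xexp m2 + yexp m2)%N && (xexp m1 < xexp m2)%N.

Definition grevlex : rel 'X_{1..2} := fun m1 m2 =>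
  (xexp m1 + yexp m1 < xexp m2 + yexp m2)%N
  || (xexp m1 + yexp m1 == xexp m2 + yexp m2)%N && (yexp m2 < yexp m1)%N.

Definition vanishing_ideal (F : fieldType) (Xi : {fset F * F}) :
    {pred {mpoly F[2]}} :=
  [pred p | all (fun q => p.@[fun k => if k == ord0 then q.1 else q.2] == 0)
                Xi].

Definition monomials (A : {fset nat * nat}) : {fset 'X_{1..2}} :=
  [fset [multinom (if k == ord0 then ij.1 else ij.2) | k < 2] | ij in A].

Definition b_x (A : {fset nat * nat}) : nat :=
  (\max_(ij <- A | ij.2 == 0) ij.1)%N.

Definition b_y (A : {fset nat * nat}) : nat :=
  (\max_(ij <- A | ij.1 == 0) ij.2)%N.

Definition L_x (s : seq nat) : {fset nat * nat} :=
  [fset ij in [seq (i, j) | j <- iota 0%N (size s),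
                          i <- iota 0%N (nth 0%N s j).+1]].

Definition L_y (s : seq nat) : {fset nat * nat} :=
  [fset ij in [seq (i, j) | i <- iota 0%N (size s),
                          j <- iota 0%N (nth 0%N s i).+1]].

Definition x_strict (A : {fset nat * nat}) : Prop :=
  exists s : seq nat, [/\ s != [::], A = L_x s & sorted gtn s].

Definition y_strict (A : {fset nat * nat}) : Prop :=
  exists s : seq nat, [/\ s != [::], A = L_y s & sorted gtn s].

Definition pi_x (F : fieldType) (Xi : {fset F * F}) : {fset F} :=
  [fset p.1 | p in Xi].
Definition pi_y (F : fieldType) (Xi : {fset F * F}) : {fset F} :=
  [fset p.2 | p in Xi].

(* The horizontal (resp. vertical) sections of Xi, listed by nonincreasing    *)
(* cardinality.                                                               *)
Definition x_lines (F : fieldType) (Xi : {fset F * F}) :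
    seq {fset F * F} :=
  sort (fun A B => #|` B| <= #|` A|)%N
       [seq [fset p in Xi | p.2 == c] | c <- pi_y Xi].

Definition y_lines (F : fieldType) (Xi : {fset F * F}) :
    seq {fset F * F} :=
  sort (fun A B => #|` B| <= #|` A|)%N
       [seq [fset p in Xi | p.1 == c] | c <- pi_x Xi].

Definition S_x (F : fieldType) (Xi : {fset F * F}) : {fset nat * nat} :=
  L_x [seq #|` A|.-1 | A <- x_lines Xi].
Definition S_y (F : fieldType) (Xi : {fset F * F}) : {fset nat * nat} :=
  L_y [seq #|` A|.-1 | A <- y_lines Xi].

Definition x_tower (F : fieldType) (Xi : {fset F * F}) : Prop :=
  x_strict (S_x Xi) /\
  exists (x : 'I_(b_x (S_x Xi)).+1 -> F) (y : 'I_(b_y (S_x Xi)).+1 -> F)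
         (sigma : 'I_(b_y (S_x Xi)).+1 -> 'S_(b_x (S_x Xi)).+1),
    [/\ injective x, injective y
      & forall p : F * F, p \in Xi <->
          exists i j, (val i, val j) \in S_x Xi /\ p = (x (sigma j i), y j)].

Definition y_tower (F : fieldType) (Xi : {fset F * F}) : Prop :=
  y_strict (S_y Xi) /\
  exists (x : 'I_(b_x (S_y Xi)).+1 -> F) (y : 'I_(b_y (S_y Xi)).+1 -> F)
         (sigma : 'I_(b_x (S_y Xi)).+1 -> 'S_(b_y (S_y Xi)).+1),
    [/\ injective x, injective y
      & forall p : F * F, p \in Xi <->
          exists i j, (val i, val j) \in S_y Xi /\ p = (x i, y (sigma i j))].

(* Main.v *)
(* In two variables both orders refine the total degree, and this is all that
   matters about them. Read Xi as a family of parallel lines carrying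
   h_0 > h_1 > ... points. Let S be the set of monomials u^i v^j with j < h_i,
   where u numbers the lines and v runs along them.

   For each corner u^i v^(h_i) of S, multiply the equations of the first i lines
   by v^(h_i) - q, where q interpolates v^(h_i) on the other lines. Newton
   interpolation, line by line, gives q of degree less than h_i because the lengths
   drop by at least one at each step. So the corner is congruent modulo I(Xi) to
   a polynomial of smaller total degree, and by induction on the degree every
   polynomial reduces to one supported in S without changing the coefficients of
   top degree in S. As 0 is the only element of I(Xi) supported in S, no leading
   monomial lies in S, and the reduced corners form the reduced Groebner basis. *)

Require Import Defs.
From mathcomp Require Import all_boot all_algebra all_fingroup.
From mathcomp Require Import finmap.
From mathcomp.multinomials Require Import mpoly.

Set Implicit Arguments.
Unset Strict Implicit.
Unset Printing Implicit Defensive.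

Import GRing.Theory.

Local Open Scope ring_scope.

(** * Leading monomials for orders refining the total degree *)

Definition degree_compatible (n : nat) (ord : rel 'X_{1..n}) : Prop :=
  (forall m1 m2, ord m1 m2 -> (mdeg m1 <= mdeg m2)%N) /\
  (forall m1 m2, (mdeg m1 < mdeg m2)%N -> ord m1 m2).

Lemma lead_mon_max (F : fieldType) (n : nat) (ord : rel 'X_{1..n})
    (p : {mpoly F[n]}) :
  degree_compatible ord -> p != 0 ->
  lead_mon ord p \in msupp p
  /\ {in msupp p, forall m, (mdeg m <= mdeg (lead_mon ord p))%N}.
Proof.
move=> [ord_le lt_ord]; rewrite -msupp_eq0 /lead_mon.
elim: (msupp p) => //= m s IHs _.
have [-> | /IHs[L_in L_max] {IHs}] := eqVneq s [::].
  (* The default [0%MM] can only win against a monomial of degree 0, which is [0%MM] itself. *)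
  rewrite big_cons big_nil; have -> : larger_mon ord m 0%MM = m.
    rewrite /larger_mon; case: ifP => // /ord_le.
    by rewrite mdeg0 leqn0 mdeg_eq0 => /eqP.
  by split=> [|m']; rewrite inE ?eqxx // => /eqP->.
rewrite big_cons; set L := \big[_/_]_(_ <- s) _ in L_in L_max *.
rewrite /larger_mon; case: ifPn => [/ord_le le_mL | /(contra (@lt_ord _ _))].
  split=> [|m']; rewrite inE ?L_in ?orbT //.
  by case/predU1P=> [-> // | /L_max].
rewrite -leqNgt => le_Lm; split=> [|m']; rewrite inE ?eqxx //.
by case/predU1P=> [-> // | /L_max /leq_trans->].
Qed.

Lemma msize_le_mdegP (R : nzRingType) (n d : nat) (p : {mpoly R[n]}) :
  reflect {in msupp p, forall m, (mdeg m < d)%N} (msize p <= d)%N.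
Proof.
apply: (iffP idP) => [p_le m /msize_mdeg_lt/leq_trans->// | lt_d].
by rewrite msizeE; apply/bigmax_leqP_seq=> m /lt_d.
Qed.

(** As [msize] is the degree plus one, the bounds mean degree at most [a] and degree less than
    [b]. *)
Lemma msizeM_bound (R : nzRingType) (n a b : nat) (p q : {mpoly R[n]}) :
  (msize p <= a.+1)%N -> (msize q <= b)%N -> (msize (p * q) <= a + b)%N.
Proof.
move=> p_le q_le; apply/msize_le_mdegP=> m /msuppM_le/allpairsP.
case=> -[m1 m2] /= [/msize_mdeg_lt m1_lt /msize_mdeg_lt m2_lt ->].
rewrite mdegD -addnS leq_add ?(leq_trans m2_lt) //.
by rewrite -ltnS (leq_trans m1_lt).
Qed.

(** All of [r] has degree below that of [c], so [c] is the only monomial of top degree and no tie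
    has to be broken. *)
Lemma lead_mon_low_tail (F : fieldType) (n : nat) (ord : rel 'X_{1..n})
    (c : 'X_{1..n}) (r : {mpoly F[n]}) :
  degree_compatible ord -> (msize r <= mdeg c)%N ->
  lead_mon ord ('X_[c] - r) = c /\ ('X_[c] - r)@_c = 1.
Proof.
move=> ord_deg r_low.
have g_c : ('X_[c] - r)@_c = 1.
  by rewrite mcoeffB mcoeffX eqxx (memN_msupp_eq0 (msize_mdeg_ge r_low)) subr0.
have c_in : c \in msupp ('X_[c] - r) by rewrite mcoeff_msupp g_c oner_neq0.
have g_neq0 : 'X_[c] - r != 0.
  by apply: contraTneq c_in => ->; rewrite msupp0.
split=> //; have [L_in L_max] := lead_mon_max ord_deg g_neq0.
have:= msuppB_le L_in; rewrite mem_cat msuppX inE => /orP[/eqP // | L_r].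
by have:= L_max c c_in; rewrite leqNgt (leq_trans (msize_mdeg_lt L_r)).
Qed.

(** * Reduction by total degree and the reduced Gröbner basis *)

Section Reduction.

Variables (F : fieldType) (n : nat) (I : {pred {mpoly F[n]}}).
Variable S : pred 'X_{1..n}.

Hypothesis I_lin :
  forall a p q, p \in I -> q \in I -> a *: p + q \in I.
Hypothesis I0 : 0 \in I.

(* Preserving the coefficients of degree at least [d - 1] inside [S] is what later
   prevents leading monomials of the ideal from lying in [S]. *)
Definition reduces_to (d : nat) (f r : {mpoly F[n]}) : Prop :=
  [/\ f - r \in I, {in msupp r, forall m, S m}, (msize r <= d)%N
    & forall m, S m -> (d <= (mdeg m).+1)%N -> r@_m = f@_m].

Lemma reduces_to_lin (d : nat) (a : F) (f1 r1 f2 r2 : {mpoly F[n]}) :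
  reduces_to d f1 r1 -> reduces_to d f2 r2 ->
  reduces_to d (a *: f1 + f2) (a *: r1 + r2).
Proof.
case=> [I1 S1 d1 top1] [I2 S2 d2 top2]; split.
- by rewrite opprD addrACA -scalerBr I_lin.
- move=> m /msuppD_le; rewrite mem_cat => /orP[/msuppZ_le/S1 | /S2] //.
- apply/msize_le_mdegP=> m /msuppD_le; rewrite mem_cat.
  by case/orP=> [/msuppZ_le|]; apply/msize_le_mdegP.
- by move=> m Sm dm; rewrite !(mcoeffD, mcoeffZ) top1 ?top2.
Qed.

(** By linearity one monomial is enough. Outside [S] it is congruent to a polynomial of smaller
    degree, to which the induction applies. *)
Lemma reduction (d : nat) (f : {mpoly F[n]}) :
  (forall m, ~~ S m -> exists2 g, g \in I & (msize (g - 'X_[m]) <= mdeg m)%N) ->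
  (msize f <= d)%N -> exists r, reduces_to d f r.
Proof.
move=> low_rewrite; elim: d f => [|d IHd] f.
  rewrite leqn0 mmeasure_poly_eq0 => /eqP->; exists 0.
  by split; rewrite ?subr0 ?msupp0 ?mmeasure0 // => m; rewrite in_nil.
move=> f_le; rewrite [f]mpolyE big_seq.
apply: (big_ind (fun h => exists r, reduces_to d.+1 h r)).
- by exists 0; split; rewrite ?subr0 ?msupp0 ?mmeasure0.
- move=> f1 f2 [r1 red1] [r2 red2]; exists (1 *: r1 + r2).
  by rewrite -[f1]scale1r; apply: reduces_to_lin.
move=> m /msize_mdeg_lt/leq_trans/(_ f_le); rewrite ltnS => m_le.
suff [r red] : exists r, reduces_to d.+1 'X_[m] r.
  exists (f@_m *: r + 0); rewrite -[X in reduces_to _ X]addr0.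
  by apply: reduces_to_lin => //; split; rewrite ?subr0 ?msupp0 ?mmeasure0.
have [Sm | nSm] := boolP (S m).
  exists 'X_[m]; split=> //; rewrite ?subrr ?msizeX // => m'.
  by rewrite msuppX inE => /eqP->.
have [g gI g_low] := low_rewrite m nSm.
have t_low : (msize ('X_[m] - g) <= d)%N.
  by rewrite -opprB mmeasureN (leq_trans g_low).
have [r [rI rS r_le r_top]] := IHd _ t_low.
exists r; split=> //.
- have -> : 'X_[m] - r = 1 *: ('X_[m] - g - r) + g.
    by rewrite scale1r addrAC subrK.
  exact: I_lin.
- exact: leqW.
(* Nothing of degree at least [d] occurs in ['X_[m] - g], and [m'] differs from [m] because it lies
   in [S]: both coefficients are 0. *)
- move=> m' Sm' dm'; rewrite ltnS in dm'; rewrite r_top ?leqW //.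
  rewrite (memN_msupp_eq0 (msize_mdeg_ge (leq_trans t_low dm'))) mcoeffX.
  by case: eqP => // eq_m; rewrite eq_m Sm' in nSm.
Qed.

End Reduction.

(** The corners are the minimal monomials outside [S]; subtracting from each its normal form
    supported in [S] gives the reduced basis. *)
Lemma groebner_escalier_lower_set (F : fieldType) (n : nat)
    (ord : rel 'X_{1..n}) (I : {pred {mpoly F[n]}}) (S : pred 'X_{1..n})
    (corners : seq 'X_{1..n}) (m : 'X_{1..n}) :
  degree_compatible ord ->
  0 \in I ->
  (forall a p q, p \in I -> q \in I -> a *: p + q \in I) ->
  (forall p q, p \in I -> q * p \in I) ->
  (forall p, p \in I -> {in msupp p, forall m, S m} -> p = 0) ->
  (forall m1 m2, (m1 <= m2)%MM -> S m2 -> S m1) ->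
  (forall m, ~~ S m -> exists2 c, c \in corners & (c <= m)%MM) ->
  {in corners, forall c, ~~ S c} ->
  {in corners &, forall c1 c2, (c1 <= c2)%MM -> c1 = c2} ->
  {in corners, forall c, exists2 g, g \in I & (msize (g - 'X_[c]) <= mdeg c)%N} ->
  groebner_escalier ord I m <-> S m.
Proof.
move=> ord_deg I0 I_lin I_mul uni S_low cover cornerN anti corner_poly.
have low_rewrite m1 : ~~ S m1 ->
    exists2 g, g \in I & (msize (g - 'X_[m1]) <= mdeg m1)%N.
  case/cover=> c c_in le_c; have [g gI g_low] := corner_poly c c_in.
  exists ('X_[m1 - c] * g); first exact: I_mul.
  rewrite -{2 3}(submK le_c) mpolyXD -mulrBr mdegD.
  by rewrite msizeM_bound ?msizeX.
pose normal c r := [&& 'X_[c] - r \in I, all S (msupp r)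
  & (msize r <= mdeg c)%N].
(* The implication makes existence hold for every [c], so that choosing normal forms gives a
   function on all monomials. *)
have normal_exists c : exists r, ~~ S c ==> normal c r.
  have [Sc | nSc] := boolP (S c); first by exists 0.
  have [g gI g_low] := low_rewrite c nSc; rewrite -mmeasureN opprB in g_low.
  have [r [rI rS r_le _]] := reduction I_lin I0 low_rewrite g_low.
  exists r; apply/and3P; split=> //; last exact/allP.
  have -> : 'X_[c] - r = 1 *: ('X_[c] - g - r) + g.
    by rewrite scale1r addrAC subrK.
  exact: I_lin.
pose R c := xchoose (normal_exists c).
have RP c : ~~ S c -> normal c (R c).
  exact/implyP/(xchooseP (normal_exists c)).
have leadR c : ~~ S c ->
    lead_mon ord ('X_[c] - R c) = c /\ ('X_[c] - R c)@_c = 1.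
  by case/RP/and3P=> _ _ R_low; apply: lead_mon_low_tail.
have RI c : ~~ S c -> 'X_[c] - R c \in I by case/RP/and3P.
have R_neq0 c : ~~ S c -> 'X_[c] - R c != 0.
  case/leadR=> _ g_c; apply/eqP=> g0; move/eqP: g_c.
  by rewrite g0 mcoeff0 eq_sym oner_eq0.
(* A leading monomial in [S] would keep its coefficient in the remainder, but the remainder lies in
   [I] with support in [S], hence is 0. *)
have leadN f : f \in I -> f != 0 -> ~~ S (lead_mon ord f).
  move=> fI f_neq0; apply/negP=> S_lead.
  have [L_in L_max] := lead_mon_max ord_deg f_neq0.
  have [r [rI rS _ r_top]] := reduction I_lin I0 low_rewrite (leqnn (msize f)).
  have r0 : r = 0.
    apply: uni rS; have -> : r = (-1) *: (f - r) + f by rewrite scaleN1r opprB subrK.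
    exact: I_lin.
  have: r@_(lead_mon ord f) = f@_(lead_mon ord f).
    by apply: r_top => //; apply/msize_le_mdegP=> m' /L_max.
  by apply/eqP; rewrite r0 mcoeff0 eq_sym -mcoeff_msupp.
split=> [[G [[GI G0 Glead] _ _] mG] | Sm].
  (* A monomial outside [S] leads an element of [I], so a leading monomial of any Gröbner basis
     divides it. *)
  apply/negPn/negP=> nSm.
  have [g gG] := Glead _ (RI m nSm) (R_neq0 m nSm).
  by rewrite (leadR m nSm).1; apply/negP/mG.
exists [fset 'X_[c] - R c | c in corners]%fset; last first.
  move=> _ /imfsetP[c /= /cornerN nSc ->]; rewrite (leadR c nSc).1.
  by apply: contra nSc => /S_low->.
split; first split.
- by move=> _ /imfsetP[c /= /cornerN nSc ->]; apply: RI.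
- apply/imfsetP=> -[c /= /cornerN nSc /esym/eqP].
  by apply/negP/R_neq0.
- move=> f fI f_neq0; have [c c_in le_c] := cover _ (leadN f fI f_neq0).
  exists ('X_[c] - R c); first by apply/imfsetP; exists c.
  by rewrite (leadR c (cornerN c c_in)).1.
- by move=> _ /imfsetP[c /= /cornerN nSc ->]; rewrite (leadR c nSc).1 (leadR c nSc).2.
(* Besides its corner, a basis element involves only monomials of [S], whose divisors stay in [S]
   and so are not corners; distinct corners do not divide each other. *)
move=> _ _ m' /imfsetP[c /= c_in ->] /imfsetP[c' /= c'_in ->] neq_g.
have nSc' := cornerN c' c'_in; rewrite (leadR c' nSc').1.
move/msuppB_le; rewrite mem_cat msuppX inE => /orP[/eqP-> | m'_in].
  by apply: contra neq_g => /anti->.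
apply: contra nSc' => /S_low->//.
by case/and3P: (RP c (cornerN c c_in)) => _ /allP/(_ m' m'_in).
Qed.

(** * Newton interpolation in one variable *)

Lemma msize_mulXsubC (F : fieldType) (n : nat) (k : 'I_n) (a : F)
    (p : {mpoly F[n]}) :
  (msize (('X_k - a%:MP) * p) <= (msize p).+1)%N.
Proof.
apply: (@msizeM_bound _ _ 1) => //; apply: leq_trans (msizeD_le _ _) _.
by rewrite geq_max msizeX mdeg1 msizeN msizeC; case: (_ != 0).
Qed.

(* Newton's form of the interpolation polynomial. *)
Lemma interpolation_in_one_variable (F : fieldType) (n : nat) (k : 'I_n)
    (ys : seq F) (w : F -> F) :
  uniq ys ->
  exists2 p : {mpoly F[n]}, (msize p <= size ys)%N
    & forall u, u k \in ys -> p.@[u] = w (u k).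
Proof.
elim: ys w => [|y0 ys IHys] w /=.
  by exists 0; rewrite ?mmeasure0 // => u; rewrite in_nil.
case/andP=> y0_ys /(IHys (fun y => (w y - w y0) / (y - y0)))[p p_le p_val].
exists ((w y0)%:MP + ('X_k - y0%:MP) * p) => [|u u_ys].
  rewrite (leq_trans (msizeD_le _ _)) // geq_max msizeC.
  by rewrite (leq_trans (msize_mulXsubC _ _ _)) ?andbT //; case: (_ != 0).
rewrite mevalD mevalM mevalB !mevalC mevalXU.
case: (eqVneq (u k) y0) => [-> | neq_y0]; first by rewrite subrr mul0r addr0.
move: u_ys; rewrite inE (negPf neq_y0) /= => u_ys.
by rewrite p_val // mulrC divfK ?subr_eq0 // addrC subrK.
Qed.

(* A set of points of the plane is given by its columns: an element [(x, ys)] of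
   [cols] stands for the points with [k0]-th coordinate [x] and other coordinate
   in [ys]. *)

Definition height (F : fieldType) (cols : seq (F * seq F)) (i : nat) : nat :=
  size (nth (0, [::]) cols i).2.

Definition distinct_columns (F : fieldType) (cols : seq (F * seq F)) : bool :=
  uniq [seq c.1 | c <- cols] && all (fun c => uniq c.2) cols.

(* Since the height is 0 beyond the last column, columns are then nonempty. *)
Definition strict_heights (F : fieldType) (cols : seq (F * seq F)) : Prop :=
  forall i, (i < size cols)%N -> (height cols i.+1 < height cols i)%N.

Definition point (F : fieldType) (k0 : 'I_2) (x y : F) : 'I_2 -> F :=
  fun k => if k == k0 then x else y.

Definition column_ideal (F : fieldType) (k0 : 'I_2) (cols : seq (F * seq F)) :
    {pred {mpoly F[2]}} :=
  [pred p | all (fun c => all (fun y => p.@[point k0 c.1 y] == 0) c.2) cols].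

Definition below_heights (F : fieldType) (k0 k1 : 'I_2)
    (cols : seq (F * seq F)) : pred 'X_{1..2} :=
  fun m => (m k1 < height cols (m k0))%N.

(** * Polynomials on a point set given by columns *)

Section Columns.

Variable F : fieldType.
Implicit Types (cols : seq (F * seq F)) (p q : {mpoly F[2]}).

Lemma column_idealP k0 cols p :
  reflect (forall c y, c \in cols -> y \in c.2 -> p.@[point k0 c.1 y] = 0)
          (p \in column_ideal k0 cols).
Proof.
apply: (iffP allP) => [H c y /H/allP H' /H'/eqP // | H c c_in].
by apply/allP=> y y_in; apply/eqP/H.
Qed.

Lemma strict_heights_behead c cols :
  strict_heights (c :: cols) -> strict_heights cols.
Proof. by move=> H i lt_i; apply: (H i.+1). Qed.

Lemma strict_heights_drop i cols :
  strict_heights cols -> strict_heights (drop i cols).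
Proof.
move=> H j; rewrite size_drop ltn_subRL => lt_j.
by rewrite /height !nth_drop addnS; apply: H.
Qed.

Lemma height_default cols i : (size cols <= i)%N -> height cols i = 0%N.
Proof. by move=> le_i; rewrite /height nth_default. Qed.

Lemma height_ltn cols i j :
  strict_heights cols -> (i < j)%N -> (i < size cols)%N ->
  (height cols j < height cols i)%N.
Proof.
move=> H; elim: j => // j IHj; rewrite ltnS leq_eqVlt => /predU1P[-> /H // | lt_ij lt_i].
apply: leq_trans (IHj lt_ij lt_i); rewrite ltnS.
have [/H/ltnW // | le_j] := ltnP j (size cols).
by rewrite height_default // leqW.
Qed.

Lemma height_leq cols i j :
  strict_heights cols -> (i <= j)%N -> (height cols j <= height cols i)%N.
Proof.
move=> H; rewrite leq_eqVlt => /predU1P[-> // | lt_ij].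
have [/(height_ltn H lt_ij)/ltnW // | le_i] := ltnP i (size cols).
by rewrite (height_default (leq_trans le_i (ltnW lt_ij))).
Qed.

(* Newton interpolation, column after column: each new factor in the variable
   [k0] has degree 1 and the next column is shorter by at least 1, so the total
   degree stays below the first height. *)
Lemma interpolation_low_degree k0 k1 cols (v : F -> F -> F) :
  k0 != k1 -> distinct_columns cols -> strict_heights cols ->
  exists2 p : {mpoly F[2]}, (msize p <= height cols 0)%N
    & forall c y, c \in cols -> y \in c.2 -> p.@[point k0 c.1 y] = v c.1 y.
Proof.
move=> neq_k; elim: cols v => [|[x0 ys] cols IHcols] v.
  by exists 0; rewrite ?mmeasure0.
case/andP=> /= /andP[x0_cols uniq_x] /andP[uniq_ys uniq_cols] strict.
have [a a_le a_val] := interpolation_in_one_variable k1 (v x0) uniq_ys.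
have dist : distinct_columns cols by apply/andP.
(* The values required of the cofactor of ['X_k0 - x0%:MP] on the remaining columns once [a] settles
   the first. *)
pose v' x y := (v x y - a.@[point k0 x y]) / (x - x0).
have [p p_le p_val] := IHcols v' dist (strict_heights_behead strict).
exists (a + ('X_k0 - x0%:MP) * p) => [|[x zs] y].
  rewrite (leq_trans (msizeD_le _ _)) // geq_max a_le.
  apply: leq_trans (msize_mulXsubC _ _ _) _.
  exact: leq_ltn_trans p_le (strict 0 isT).
rewrite /= mevalD mevalM mevalB mevalC mevalXU {2}/point eqxx.
rewrite inE => /predU1P[[-> ->] y_in | xzs_in y_in].
  rewrite subrr mul0r addr0 a_val.
    by rewrite /point eq_sym (negPf neq_k).
  by rewrite /point eq_sym (negPf neq_k).
have neq_x : x - x0 != 0.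
  rewrite subr_eq0; apply: contraNneq x0_cols => <-.
  exact: (map_f fst xzs_in).
by rewrite (p_val _ _ xzs_in y_in) /v' mulrC divfK // addrC subrK.
Qed.

(** This lets the top-degree part of a corner polynomial be computed factor by factor. *)
Lemma low_tailM n (c d : 'X_{1..n}) (p q : {mpoly F[n]}) :
  (msize (p - 'X_[c]) <= mdeg c)%N -> (msize (q - 'X_[d]) <= mdeg d)%N ->
  (msize (p * q - 'X_[c + d]) <= mdeg (c + d))%N.
Proof.
move=> p_low q_low; rewrite mpolyXD mdegD.
have -> : p * q - 'X_[c] * 'X_[d] = q * (p - 'X_[c]) + 'X_[c] * (q - 'X_[d]).
  by rewrite !mulrBr ![q * _]mulrC addrA subrK.
apply: leq_trans (msizeD_le _ _) _; rewrite geq_max; apply/andP; split.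
  rewrite addnC msizeM_bound // -[q](subrK 'X_[d]).
  by rewrite (leq_trans (msizeD_le _ _)) // geq_max msizeX (leqW q_low) /=.
by rewrite msizeM_bound ?msizeX.
Qed.

Lemma low_tail_prod n (k : 'I_n) (xs : seq F) :
  (msize (\prod_(x <- xs) ('X_k - x%:MP) - 'X_[U_(k) *+ size xs] : {mpoly F[n]})
     <= mdeg (U_(k) *+ size xs)%MM)%N.
Proof.
elim: xs => [|x xs IHxs]; first by rewrite big_nil mulm0n mpolyX0 subrr mmeasure0.
rewrite big_cons mulmS; apply: low_tailM => //.
by rewrite addrAC subrr add0r msizeN msizeC mdeg1; case: (_ != 0).
Qed.

(** The case [i = size cols] is a corner too: the height there is 0, which leaves a pure power of
    the variable [k0]. *)
Definition corner k0 k1 cols (i : nat) : 'X_{1..2} :=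
  (U_(k0) *+ i + U_(k1) *+ height cols i)%MM.

Lemma corner_polynomial k0 k1 cols i :
  k0 != k1 -> distinct_columns cols -> strict_heights cols ->
  (i <= size cols)%N ->
  exists2 g, g \in column_ideal k0 cols
    & (msize (g - 'X_[corner k0 k1 cols i]) <= mdeg (corner k0 k1 cols i))%N.
Proof.
move=> neq_k /andP[uniq_x uniq_cols] strict le_i.
have dist_drop : distinct_columns (drop i cols).
  rewrite /distinct_columns map_drop drop_uniq //=.
  by apply/allP=> c /mem_drop/(allP uniq_cols).
have [p p_le p_val] := interpolation_low_degree
  (fun _ y => y ^+ height cols i) neq_k dist_drop (@strict_heights_drop i cols strict).
pose N : {mpoly F[2]} :=
  \prod_(x <- [seq c.1 | c <- take i cols]) ('X_k0 - x%:MP).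
(* [N] vanishes on the first [i] columns, the other factor on the rest. For [i = size cols] no
   column remains, [p] is 0 and the second factor is 1. *)
exists (N * ('X_[U_(k1) *+ height cols i] - p)).
  apply/column_idealP=> c y; rewrite -{1}[cols](cat_take_drop i) mem_cat mevalM.
  case/orP=> [c_in _ | c_in y_in]; last first.
    rewrite mevalB (p_val c y c_in y_in) -mpolyXn rmorphXn /= mevalXU /point.
    by rewrite eq_sym (negPf neq_k) subrr mulr0.
  suff -> : N.@[point k0 c.1 y] = 0 by rewrite mul0r.
  rewrite /N (big_rem c.1) ?map_f //= mevalM mevalB mevalXU mevalC.
  by rewrite /point eqxx subrr mul0r.
have -> : i = size [seq c.1 | c <- take i cols] by rewrite size_map size_takel.
apply: low_tailM; first exact: low_tail_prod.
rewrite size_map size_takel // addrAC subrr add0r msizeN.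
rewrite mdegMn mdeg1 mul1n.
by rewrite (leq_trans p_le) // /height nth_drop addn0.
Qed.

(** On the first column [f] has too many roots for its degree, so the equation of that column
    divides [f]; the quotient satisfies the hypotheses for the remaining columns. *)
Lemma bipoly_vanishing_eq0 cols (f : {poly {poly F}}) :
  distinct_columns cols -> strict_heights cols ->
  (forall i, size (f`_i)%R <= height cols i)%N ->
  (forall c y, c \in cols -> y \in c.2 -> f.[c.1%:P].[y] = 0) ->
  f = 0.
Proof.
elim: cols f => [|[x0 ys] cols IHcols] f.
  move=> _ _ f_small _; apply/polyP=> i; rewrite coef0; apply/eqP.
  by rewrite -size_poly_leq0 (leq_trans (f_small i)) // height_default.
case/andP=> /= /andP[x0_cols uniq_x] /andP[uniq_ys uniq_cols] strict f_small f_van.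
have f_x0 : f.[x0%:P] = 0.
  apply: (@roots_geq_poly_eq0 _ _ ys) => //.
    apply/allP=> y y_in; apply/rootP.
    by apply: (f_van (x0, ys)); rewrite ?mem_head.
  rewrite horner_coef; apply: leq_trans (size_sum _ _ _) _.
  apply/bigmax_leqP=> i _; rewrite -polyC_exp mulrC mul_polyC.
  apply: leq_trans (size_scale_leq _ _) (leq_trans (f_small i) _).
  exact: (height_leq strict (leq0n i)).
have /factor_theorem[q def_f] : root f x0%:P by apply/rootP.
suff q0 : q = 0 by rewrite def_f q0 mul0r.
apply: IHcols => [||i|c y c_in y_in].
- by apply/andP.
- exact: strict_heights_behead strict.
(* Synthetic division bounds the coefficients of [q] from the top down, by induction on the distance
   [k]. The shift to [j.+1] in [f] matches the removal of the first column. *)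
- have q_small k j : (size q <= j + k)%N -> (size (q`_j)%R <= height cols j)%N.
    elim: k j => [|k IHk] j le_q.
      by rewrite addn0 in le_q; rewrite nth_default ?size_poly0.
    have -> : q`_j = f`_j.+1 + x0 *: q`_j.+1.
      by rewrite def_f mulrBr coefB coefMX coefMC /= mulrC mul_polyC subrK.
    apply: leq_trans (size_polyD _ _) _; rewrite geq_max.
    rewrite (leq_trans (f_small j.+1)) //=.
    apply: leq_trans (size_scale_leq _ _) _.
    apply: leq_trans (IHk _ _) (height_leq (strict_heights_behead strict) _) => //.
    by rewrite addSnnS.
  by apply: (q_small (size q)); rewrite leq_addl.
have := f_van c y; rewrite inE c_in orbT def_f hornerM hornerXsubC => /(_ isT y_in).
rewrite -polyCB hornerM hornerC => /eqP; rewrite mulf_eq0 subr_eq0 => /predU1P[// | /eqP eq_x].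
by move: x0_cols; rewrite -eq_x map_f.
Qed.

Lemma ord2_cases (k0 k1 i : 'I_2) : k0 != k1 -> i = k0 \/ i = k1.
Proof.
move=> neq_k; have [-> | neq_i] := eqVneq i k0; [by left | right].
by apply/eqP; move: k0 k1 i neq_k neq_i; do 3![case=> -[|[|//]] ?].
Qed.

Lemma big_ord2_pair (R : Type) (idx : R) (op : Monoid.com_law idx) (k0 k1 : 'I_2)
    (E : 'I_2 -> R) :
  k0 != k1 -> \big[op/idx]_i E i = op (E k0) (E k1).
Proof.
move=> neq_k; rewrite (bigD1 k0) //= (bigD1 k1) 1?eq_sym //=.
rewrite big1 ?Monoid.mulm1 // => i /andP[/eqP neq0 /eqP neq1].
by case: (ord2_cases i neq_k).
Qed.

Lemma mnm2P (k0 k1 : 'I_2) (m m' : 'X_{1..2}) :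
  k0 != k1 -> m k0 = m' k0 -> m k1 = m' k1 -> m = m'.
Proof.
by move=> neq_k eq0 eq1; apply/mnmP=> i; case: (ord2_cases i neq_k) => ->.
Qed.

Lemma mnm2_lep (k0 k1 : 'I_2) (m m' : 'X_{1..2}) :
  k0 != k1 -> (m k0 <= m' k0)%N -> (m k1 <= m' k1)%N -> (m <= m')%MM.
Proof.
by move=> neq_k le0 le1; apply/mnm_lepP=> i; case: (ord2_cases i neq_k) => ->.
Qed.

Lemma column_ideal_unisolvent k0 k1 cols p :
  k0 != k1 -> distinct_columns cols -> strict_heights cols ->
  p \in column_ideal k0 cols ->
  {in msupp p, forall m, below_heights k0 k1 cols m} -> p = 0.
Proof.
move=> neq_k dist strict /column_idealP p_van p_supp.
(* The outer variable is [k0], so that the heights bound the sizes of the coefficients, which are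
   polynomials in [k1]. *)
pose f : {poly {poly F}} :=
  \sum_(m <- msupp p) (p@_m *: 'X^(m k1))%:P * 'X^(m k0).
have f_coef i : f`_i = \sum_(m <- msupp p | m k0 == i) p@_m *: 'X^(m k1).
  rewrite coef_sum [RHS]big_mkcond /=; apply: eq_bigr => m _.
  by rewrite coefCM coefXn eq_sym; case: eqP; rewrite ?mulr1 ?mulr0.
have f0 : f = 0.
  apply: (bipoly_vanishing_eq0 dist strict) => [i | c y c_in y_in].
    rewrite f_coef; apply: leq_trans (size_sum _ _ _) _.
    apply/bigmax_leqP_seq=> m m_in /eqP <-.
    apply: leq_trans (size_scale_leq _ _) _.
    by rewrite size_polyXn; apply: p_supp.
  rewrite -[RHS](p_van c y c_in y_in) mevalE !horner_sum.
  apply: eq_bigr => m _; rewrite (big_ord2_pair _ _ neq_k) /point eqxx.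
  rewrite eq_sym (negPf neq_k) !hornerE.
  by rewrite /= mulrAC.
apply/mpolyP=> m; rewrite mcoeff0; have := f_coef (m k0).
rewrite f0 coef0 => /(congr1 (fun h : {poly F} => h`_(m k1))).
rewrite coef0 coef_sum => /esym/eqP; have [m_in | /memN_msupp_eq0 //] := boolP (m \in msupp p).
rewrite big_mkcond (bigD1_seq m) ?msupp_uniq //= eqxx coefZ coefXn eqxx mulr1.
rewrite big1 ?addr0 => [/eqP // | m' neq_m]; case: eqP => // eq0.
rewrite coefZ coefXn; case: eqP => [eq1 | _]; last by rewrite mulr0.
by rewrite (mnm2P neq_k eq0 (esym eq1)) eqxx in neq_m.
Qed.

Lemma groebner_escalier_columns (ord : rel 'X_{1..2}) k0 k1 cols m :
  degree_compatible ord -> k0 != k1 ->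
  distinct_columns cols -> strict_heights cols ->
  groebner_escalier ord (column_ideal k0 cols) m
    <-> below_heights k0 k1 cols m.
Proof.
move=> ord_deg neq_k dist strict.
have corner0 i : corner k0 k1 cols i k0 = i.
  by rewrite mnmDE !mulmnE !mnm1E eqxx eq_sym (negPf neq_k) mul1n addn0.
have corner1 i : corner k0 k1 cols i k1 = height cols i.
  by rewrite mnmDE !mulmnE !mnm1E eqxx (negPf neq_k) mul1n.
pose corners := [seq corner k0 k1 cols i | i <- iota 0 (size cols).+1].
apply: (@groebner_escalier_lower_set _ _ _ _ _ corners) => //.
- by apply/column_idealP=> *; rewrite meval0.
- move=> a p q /column_idealP p_van /column_idealP q_van.
  apply/column_idealP=> c y c_in y_in.
  by rewrite mevalD mevalZ p_van // q_van // mulr0 addr0.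
- move=> p q /column_idealP p_van; apply/column_idealP=> c y c_in y_in.
  by rewrite mevalM p_van // mulr0.
- by move=> p; apply: column_ideal_unisolvent.
- move=> m1 m2 /mnm_lepP le_m lt_m2; apply: leq_ltn_trans (le_m k1) _.
  exact: leq_trans lt_m2 (height_leq strict (le_m k0)).
(* The corner in the column of [m1], or the last corner, a power of [k0], when [m1] lies beyond all
   columns. *)
- move=> m1; rewrite -leqNgt => le_m1; exists (corner k0 k1 cols (minn (m1 k0) (size cols))).
    by apply/map_f; rewrite mem_iota ltnS geq_minr.
  apply: (mnm2_lep neq_k); rewrite ?corner0 ?corner1 ?geq_minl //.
  by have [//|le_size] := leqP (m1 k0) (size cols); rewrite height_default.
- move=> _ /mapP[i _ ->].
  by rewrite /below_heights corner0 corner1 ltnn.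
(* Divisibility forces the index to grow without the height dropping, which strict decrease allows
   only for equal indices. *)
- move=> _ _ /mapP[i _ ->] /mapP[j j_in ->] /mnm_lepP le_ij.
  have := le_ij k0; have := le_ij k1; rewrite !corner0 !corner1.
  move=> le_h; rewrite leq_eqVlt => /predU1P[-> // | lt_ij].
  move: j_in; rewrite mem_iota ltnS => /(leq_trans lt_ij) lt_i.
  by rewrite leqNgt (height_ltn strict lt_ij lt_i) in le_h.
- move=> _ /mapP[i i_in ->]; apply: corner_polynomial => //.
  by rewrite mem_iota ltnS in i_in.
Qed.

End Columns.

(** * The two orders and the exponent sets [L_x], [L_y] *)

Lemma groebner_escalier_ext (F : fieldType) (n : nat) (ord : rel 'X_{1..n})
    (I J : {pred {mpoly F[n]}}) (m : 'X_{1..n}) :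
  I =i J -> groebner_escalier ord I m <-> groebner_escalier ord J m.
Proof.
have half I1 I2 : I1 =i I2 -> groebner_escalier ord I1 m ->
    groebner_escalier ord I2 m.
  move=> eqI [G [[GI G0 G_lead] G_monic G_red] Gm]; exists G => //.
  split=> //; split=> // [g /GI | f]; first by rewrite eqI.
  by rewrite -eqI; apply: G_lead.
by move=> eqIJ; split; apply: half.
Qed.

Lemma mdeg2 (m : 'X_{1..2}) : mdeg m = (xexp m + yexp m)%N.
Proof. by rewrite mdegE (@big_ord2_pair _ _ _ ord0 ord_max). Qed.

Lemma grlex_degree_compatible : degree_compatible grlex.
Proof.
split=> m1 m2; rewrite !mdeg2 /grlex; last by move->.
by case/orP=> [/ltnW // | /andP[/eqP-> ]].
Qed.

Lemma grevlex_degree_compatible : degree_compatible grevlex.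
Proof.
split=> m1 m2; rewrite !mdeg2 /grevlex; last by move->.
by case/orP=> [/ltnW // | /andP[/eqP-> ]].
Qed.

Lemma mem_monomials (A : {fset nat * nat}) (m : 'X_{1..2}) :
  (m \in monomials A) = ((xexp m, yexp m) \in A).
Proof.
apply/imfsetP/idP => [[[i j] /= ij_in ->] | m_in].
  by rewrite /xexp /yexp !mnmE.
exists (xexp m, yexp m) => //=.
by apply: (@mnm2P ord0 ord_max); rewrite // mnmE.
Qed.

Lemma mem_L_y (s : seq nat) (i j : nat) :
  ((i, j) \in L_y s) = (i < size s)%N && (j <= nth 0%N s i)%N.
Proof.
rewrite in_fset; apply/allpairsPdep/andP => [[a [b [a_in b_in [-> ->]]]] | [lt_i le_j]].
  by move: a_in b_in; rewrite !mem_iota !add0n !leq0n ltnS /= => -> ->.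
by exists i, j; rewrite !mem_iota !add0n ltnS.
Qed.

Lemma mem_L_x (s : seq nat) (i j : nat) :
  ((i, j) \in L_x s) = ((j, i) \in L_y s).
Proof.
rewrite mem_L_y in_fset.
apply/allpairsPdep/andP => [[a [b [a_in b_in [-> ->]]]] | [lt_i le_j]].
  by move: a_in b_in; rewrite !mem_iota !add0n !leq0n ltnS /= => -> ->.
by exists j, i; rewrite !mem_iota !add0n ltnS.
Qed.

(** Strictness is stated for some sequence describing the set; injectivity identifies it with the
    sequence of line lengths. *)
Lemma L_y_inj : injective L_y.
Proof.
move=> s t eq_st.
have eq_mem i j : (i < size s)%N && (j <= nth 0 s i)%N =
                  (i < size t)%N && (j <= nth 0 t i)%N.
  by rewrite -!mem_L_y eq_st.
have eq_lt i : (i < size s)%N = (i < size t)%N.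
  by have:= eq_mem i 0; rewrite !andbT.
have eq_size : size s = size t.
  by apply/eqP; rewrite eqn_leq leqNgt eq_lt -leqNgt leqnn leqNgt -eq_lt -leqNgt leqnn.
apply: (@eq_from_nth _ 0) => // i lt_i; apply/eqP; rewrite eqn_leq.
have:= eq_mem i (nth 0 s i); have:= eq_mem i (nth 0 t i).
by rewrite lt_i -eq_lt lt_i /= !leqnn => -> <-.
Qed.

Lemma L_x_inj : injective L_x.
Proof.
move=> s t eq_st; apply: L_y_inj; apply/fsetP=> -[i j].
by rewrite -!mem_L_x eq_st.
Qed.

(** * The parallel lines of a point set as columns *)

Section Lines.

Variables (F : fieldType) (Xi : {fset F * F}).
(* [pr] is constant on the lines, [pr'] is the coordinate along them. *)
Variables (pr pr' : F * F -> F).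
Hypothesis pr_inj : forall p q, pr p = pr q -> pr' p = pr' q -> p = q.

Definition line (c : F) : {fset F * F} := [fset p in Xi | pr p == c]%fset.

(** For [pr] equal to [snd] or [fst] this is, by conversion, the sequence inside [S_x] or [S_y]. *)
Definition line_lengths : seq nat :=
  [seq #|` A|.-1 | A <- sort (fun A B : {fset F * F} => #|` B| <= #|` A|)%N
                           [seq line c | c <- [fset pr p | p in Xi]%fset]].

(** Sorting coordinates instead of lines keeps each line paired with its coordinate; sorting
    commutes with the map, so the order is that of [line_lengths]. *)
Definition columns : seq (F * seq F) :=
  [seq (c, [seq pr' p | p <- line c])
     | c <- sort (fun c d => #|` line d| <= #|` line c|)%N
                 [fset pr p | p in Xi]%fset].

Lemma columns_lengths : line_lengths = [seq (size c.2).-1 | c <- columns].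
Proof.
rewrite /line_lengths /columns sort_map -!map_comp.
by apply: eq_map => c /=; rewrite size_map.
Qed.

Lemma distinct_columns_lines : distinct_columns columns.
Proof.
apply/andP; split.
  by rewrite -map_comp map_id_in // sort_uniq fset_uniq.
apply/allP=> _ /mapP[c _ ->] /=; rewrite map_inj_in_uniq ?fset_uniq // => p q.
by rewrite !inE => /andP[_ /eqP eq_p] /andP[_ /eqP eq_q]; apply: pr_inj; rewrite eq_p.
Qed.

Lemma columns_nonempty c : c \in columns -> (0 < size c.2)%N.
Proof.
case/mapP=> d; rewrite mem_sort => /imfsetP[p /= p_in ->] -> /=.
rewrite size_map cardfs_gt0; apply/fset0Pn; exists p.
by rewrite !inE p_in eqxx.
Qed.

Lemma height_columns i :
  (i < size columns)%N -> height columns i = (nth 0 line_lengths i).+1.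
Proof.
move=> lt_i; rewrite columns_lengths (nth_map (0, [::])) // prednK //.
by apply/columns_nonempty/mem_nth.
Qed.

Lemma strict_heights_lines : sorted gtn line_lengths -> strict_heights columns.
Proof.
move=> /(sortedP 0) strict i lt_i; rewrite (height_columns lt_i).
(* After the last column the height is 0, while the last column is nonempty. *)
have [lt_Si | le_Si] := ltnP i.+1 (size columns); last by rewrite height_default.
by rewrite height_columns // ltnS; apply: strict; rewrite columns_lengths size_map.
Qed.

Lemma below_heights_lines k0 k1 m :
  below_heights k0 k1 columns m = ((m k0, m k1) \in L_y line_lengths).
Proof.
rewrite mem_L_y /below_heights; have -> : size line_lengths = size columns.
  by rewrite columns_lengths size_map.
by have [/height_columns-> | /height_default->] := ltnP (m k0) (size columns).
Qed.

Lemma column_ideal_lines (k0 : 'I_2) :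
  (forall p, (fun k => if k == ord0 then p.1 else p.2) =1 point k0 (pr p) (pr' p)) ->
  vanishing_ideal Xi =i column_ideal k0 columns.
Proof.
move=> point_pr f; apply/allP/column_idealP => [f_van _ y /mapP[c _ ->] | f_van p p_in].
  case/mapP=> p /=; rewrite !inE => /andP[p_in /eqP <-] ->.
  by rewrite -(meval_eq _ (point_pr p)); apply/eqP/f_van.
apply/eqP; rewrite (meval_eq _ (point_pr p)).
apply: (f_van (pr p, [seq pr' q | q <- line (pr p)])).
  apply: (map_f (fun c => (c, [seq pr' q | q <- line c]))).
  by rewrite mem_sort; apply/imfsetP; exists p.
by apply: map_f; rewrite !inE p_in eqxx.
Qed.

Lemma groebner_escalier_lines (ord : rel 'X_{1..2}) (k0 k1 : 'I_2) (m : 'X_{1..2}) :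
  degree_compatible ord -> k0 != k1 ->
  (forall p, (fun k => if k == ord0 then p.1 else p.2) =1 point k0 (pr p) (pr' p)) ->
  sorted gtn line_lengths ->
  groebner_escalier ord (vanishing_ideal Xi) m
    <-> (m k0, m k1) \in L_y line_lengths.
Proof.
move=> ord_deg neq_k point_pr strict; rewrite -below_heights_lines.
apply: iff_trans (groebner_escalier_ext _ _ (column_ideal_lines point_pr)) _.
apply: groebner_escalier_columns => //; first exact: distinct_columns_lines.
exact: strict_heights_lines.
Qed.

End Lines.

Theorem theorem3p1 (F : fieldType) (Xi : {fset F * F})
    (Xi_neq0 : Xi <> fset0) :
  (x_tower Xi -> forall m : 'X_{1..2},
     groebner_escalier grlex (vanishing_ideal Xi) m
       <-> m \in monomials (S_x Xi))
  /\
  (y_tower Xi -> forall m : 'X_{1..2},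
     groebner_escalier grevlex (vanishing_ideal Xi) m
       <-> m \in monomials (S_y Xi)).
Proof.
split=> -[[s [_ eq_s sorted_s]] _] m; rewrite mem_monomials.
  have lengths_s : line_lengths Xi snd = s := L_x_inj eq_s.
  (* Horizontal lines are numbered by y, so [L_x] is read as a transposed [L_y] and y takes the role
     of [k0]. *)
  rewrite eq_s mem_L_x -lengths_s.
  apply: (groebner_escalier_lines (pr' := fst)) => //.
  - by case=> [a b] [c d] /= -> ->.
  - exact: grlex_degree_compatible.
  - by move=> p k; rewrite /point; case: (@ord2_cases ord0 ord_max k isT) => ->.
  - by rewrite lengths_s.
have lengths_s : line_lengths Xi fst = s := L_y_inj eq_s.
rewrite eq_s -lengths_s.
apply: (groebner_escalier_lines (pr' := snd)) => //.
- by case=> [a b] [c d] /= -> ->.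
- exact: grevlex_degree_compatible.
- by rewrite lengths_s.
Qed.
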